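(* Let $R$ be the set of records of $f_3$, and let $\mathcal A$ be the set of all $a\in\mathbb N$ such that $f_a$ is eventually the identity. Then $$\mathcal A=\{2,4\}\cup\{a\in\mathbb N : a\equiv 0 \pmod 6 \text{ and there exists a record } r\in R \text{ with } |r-a|\le 1\}.$$
   Context: $\mathbb N=\{1,2,3,\dots\}$. For $a\in\mathbb N$, the function $f_a:\mathbb N\to\mathbb N$ is defined recursively by $f_a(1)=1$, $f_a(2)=a$, and, for each $n\ge 3$, $f_a(n)$ is the smallest positive integer that is not in $\{f_a(1),\dots,f_a(n-1)\}$ and is coprime with $f_a(n-1)$. The function $f_a$ is eventually the identity if there exists $m$ such that $f_a(n)=n$ for all $n>m$. A turning point of $f=f_a$ is a natural number $t$ such that either (i) $t>3$ and $f(t)-f(t-1)>1$, or (ii) $t=3$ and $f(3)\neq\min(\mathbb N\setminus\{1,a\})$. A record of $f$ is a value $f(t)$ where $t$ is a turning point of $f$. (For $a=3$ one has $f_3(3)=2$, so $t=3$ is not a turning point of $f_3$.) *)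

(* Defs.v *)
From mathcomp Require Import all_boot all_order all_algebra.
From mathcomp Require Import boolp classical_sets.

Set Implicit Arguments.
Unset Strict Implicit.
Unset Printing Implicit Defensive.

Local Open Scope nat_scope.

(* The positive integers are represented by [nat] with explicit positivity
   conditions. *)

Definition is_least (P : nat -> Prop) (m : nat) : Prop :=
  P m /\ forall k, P k -> m <= k.

(* [s] is the list of the previous values, most recent first.  The guard
   [0 < head 0 s] only makes the search total: it holds along [f_ a] as soon
   as [0 < a] (see [f_gt0]; [f_rec] is the defining recursion). *)
Definition admissible (s : seq nat) : pred nat := fun m =>
  [&& 0 < m, m \notin s & (0 < head 0 s) ==> coprime m (head 0 s)].

Lemma ex_admissible (s : seq nat) : exists m, admissible s m.
Proof.
pose x := maxn 1 (head 0 s); exists (x * (sumn s).+1).+1.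
have x_gt0 : 0 < x by rewrite leq_max.
have le_sumn y : y \in s -> y <= sumn s.
  elim: s {x x_gt0} => //= z s IHs; rewrite inE => /orP[/eqP->|/IHs].
    exact: leq_addr.
  by move=> /leq_trans; apply; exact: leq_addl.
apply/and3P; split=> //.
  apply/negP=> /le_sumn; rewrite leqNgt ltnS.
  by rewrite (leq_trans (leqnSn _)) // leq_pmull.
apply/implyP=> h_gt0; have -> : x = head 0 s by apply/maxn_idPr.
by rewrite /coprime -addn1 mulnC gcdnC gcdnMDl gcdn1.
Qed.

(* [:: f_a(n); ...; f_a(1)] *)
Fixpoint history (a n : nat) : seq nat :=
  match n with
  | 0 => [::]
  | 1 => [:: 1]
  | 2 => [:: a; 1]
  | n'.+1 => let s := history a n' in ex_minn (ex_admissible s) :: s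
  end.

(* The values at the index [0] are junk. *)
Definition f_ (a n : nat) : nat := head 0 (history a n).

Definition eventually_identity (a : nat) : Prop :=
  exists m, forall n, m < n -> f_ a n = n.

Definition turning_point (a t : nat) : Prop :=
  (3 < t /\ (1 < (f_ a t)%:Z - (f_ a t.-1)%:Z)%R)
  \/ (t = 3 /\ ~ is_least (fun m => [/\ 0 < m, m <> 1 & m <> a]) (f_ a 3)).

Definition records (a : nat) : set nat :=
  [set r | exists t, turning_point a t /\ r = f_ a t]%classic.

Definition eventually_identity_starts : set nat :=
  [set a | 0 < a /\ eventually_identity a]%classic.

Lemma f_1 (a : nat) : f_ a 1 = 1. Proof. by []. Qed.

Lemma f_2 (a : nat) : f_ a 2 = a. Proof. by []. Qed.

Lemma historyS (a n : nat) : 3 <= n ->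
  history a n = ex_minn (ex_admissible (history a n.-1)) :: history a n.-1.
Proof. by case: n => [|[|[|n]]]. Qed.

Lemma mem_history (a n y : nat) :
  (y \in history a n) <-> (exists k, [/\ 0 < k, k <= n & y = f_ a k]).
Proof.
have step m : history a m.+1 = f_ a m.+1 :: history a m by case: m => [|[|m]].
elim: n => [|n IHn]; first by split=> // -[[|k] []].
rewrite step inE; split=> [/orP[/eqP->|/IHn[k [k0 kn ->]]]|[k [k0]]].
- by exists n.+1.
- by exists k; split=> //; exact: leqW.
rewrite leq_eqVlt => /orP[/eqP-> ->|kn yE]; first by rewrite eqxx.
by apply/orP; right; apply/IHn; exists k.
Qed.

Lemma f_gt0 (a n : nat) : 0 < a -> 0 < n -> 0 < f_ a n.
Proof.
case: n => [|[|[|n]]] // _ _; rewrite /f_ historyS //=.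
by case: ex_minnP => m /and3P[].
Qed.

Lemma f_rec (a n : nat) : 0 < a -> 3 <= n ->
  is_least (fun m => [/\ 0 < m,
                         forall k, 0 < k -> k < n -> m <> f_ a k &
                         coprime m (f_ a n.-1)])
           (f_ a n).
Proof.
move=> a_gt0 n_ge3; have n0 : 0 < n.-1 by case: n n_ge3 => [|[]].
have En : n.-1.+1 = n by case: n n_ge3 {n0}.
have adm m : admissible (history a n.-1) m <->
    [/\ 0 < m, forall k, 0 < k -> k < n -> m <> f_ a k &
        coprime m (f_ a n.-1)].
  rewrite /admissible -/(f_ a n.-1) f_gt0 //=; split.
    case/and3P=> m0 mN cop; split=> // k k0; rewrite -En ltnS => kn mE.
    by move/negP: mN; apply; apply/mem_history; exists k.
  case=> m0 mN cop; rewrite m0 cop andbT /=; apply/negP=> /mem_history.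
  by case=> k [k0 kn]; apply: mN; rewrite // -En ltnS.
have -> : f_ a n = ex_minn (ex_admissible (history a n.-1)).
  by rewrite /f_ historyS.
case: ex_minnP => m /(proj1 (adm m)) Pm min_m.
by split=> // k /(proj2 (adm k))/min_m.
Qed.

(* Main.v *)
Require Import Defs.
From mathcomp Require Import all_boot all_order all_algebra.
From mathcomp Require Import boolp classical_sets.
From mathcomp Require Import zify.

(** The sequences move by alternating two kinds of steps. Suppose the values
so far are exactly 1, ..., e+1 (and possibly [a]) and the last one is the even
number e. The next value is the least e+j, with j > 1, coprime to e, that is
e+g where g = [gap e] is the least prime not dividing e. A prime dividing both
e+g and a number strictly between e and e+g would be smaller than g, so it
would divide e and hence g; therefore e+2, ..., e+g-1 follow in increasing
order ([swept_next]), and the situation recurs with e replaced by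
[next e] = e+g-1.
Starting from e = 2 this recursion yields the [pivot]s 2, 4, 6, 10, 12, ...
It governs f_3, whose records are therefore the numbers 1 + [pivot k], k > 0
([records3]). The recursion jumps over no odd prime, so p-1 is a pivot for each
of them ([prime_pivot]). A sequence that meets the situation with
[a] <= e+1 takes the value e at place e+1 for infinitely many e, so it is not
eventually the identity ([swept_not_identity]).

An odd [a] leads there at once with e = a-1, or gives f(n) = n-1 when a = 1.
For even a > 2 the sequence starts 1, a, p, 2, 3, ..., p-1 with p = [gap a], so
it follows the pivots, with a still ahead, until a lies in the next interval
to be filled, pivot k < a <= pivot (k+1). There [swept_cross] compares what can
happen when the filling passes over [a]. If a < pivot (k+1) the filling
continues after a, and the situation above recurs with a behind. If a =
pivot (k+1), all of 1, ..., a+1 have been used when the filling ends, the last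
value being a-1, or a+1 when the gap is 3 and nothing but a was left to fill.
The identity sets in provided a+2 is coprime to that value, which fails exactly
when the gap is not 3 and 3 divides a-1.

It remains to read this modulo 6 ([pivotS_mod6]): pivots other than 2 are 0 or
4 modulo 6, and from a pivot that is 4 modulo 6 the next one is 2 larger. So
the even a > 2 that work are 4 and the pivots divisible by 6. A multiple a of 6
is a pivot if and only if it differs by one from some record 1 + pivot k:
either a = pivot k, or a = 2 + pivot k, and then pivot k is 4 modulo 6, so that
a is the next pivot. *)

Set Implicit Arguments.
Unset Strict Implicit.
Unset Printing Implicit Defensive.

Local Open Scope nat_scope.

(** * Elementary moves of the sequence *)

Lemma history_cons a n : history a n.+1 = f_ a n.+1 :: history a n.
Proof. by case: n => [|[|n]]. Qed.

Lemma f_step a n w : 0 < a -> 2 <= n -> 0 < w -> w \notin history a n ->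
  coprime w (f_ a n) ->
  (forall k, 0 < k < w -> coprime k (f_ a n) -> k \in history a n) ->
  f_ a n.+1 = w.
Proof.
move=> a_gt0 n_ge2 w_gt0 wN cw min_w.
have [[v_gt0 vN cv] min_v] := @f_rec a n.+1 a_gt0 n_ge2.
have le_vw : f_ a n.+1 <= w.
  apply: min_v; split=> // k k0 kn wE; move/negP: wN; apply.
  by apply/mem_history; exists k.
apply/eqP; rewrite eqn_leq le_vw leqNgt; apply/negP => lt_vw.
have /mem_history[k [k0 kn vE]] : f_ a n.+1 \in history a n.
  by apply: min_w => //; rewrite v_gt0.
exact: (vN k).
Qed.

(** Once everything below [x] is used, consecutive integers being coprime, the
sequence counts upwards for as long as the integers it meets are fresh. *)
Lemma f_sweep a n x m : 0 < a -> 2 <= n -> 0 < x -> coprime x (f_ a n) ->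
  (forall y, 0 < y < x -> y \in history a n) ->
  (forall y, x <= y < x + m -> y \notin history a n) ->
  (forall i, i < m -> f_ a (n + i).+1 = x + i) /\
  (forall y, (y \in history a (n + m)) =
             (x <= y < x + m) || (y \in history a n)).
Proof.
move=> a_gt0 n_ge2 x_gt0 cx below; elim: m => [|m IHm] fresh.
  by rewrite !addn0; split=> // y; case: ltngtP.
have [|fE hE] := IHm; first by move=> y ?; apply: fresh; lia.
have fS : f_ a (n + m).+1 = x + m.
  apply: f_step; [by []|lia|lia| | |].
  - by rewrite hE ltnn andbF; apply: fresh; lia.
  - case: m fE {IHm fresh hE} => [|m] fE; first by rewrite !addn0.
    by rewrite !addnS fE // coprimeSn.
  - move=> k /andP[k0 kx] _; rewrite hE kx andbT.
    by case: (leqP x k) => // kx'; rewrite below ?k0.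
split=> [i|y].
  by rewrite ltnS leq_eqVlt => /predU1P[->|/fE].
rewrite addnS history_cons inE hE fS.
by case: (y \in history a n); rewrite ?orbT ?orbF //; lia.
Qed.

Lemma identity_from a n : 0 < a -> 2 <= n ->
  history a n =i [pred y | 0 < y <= n] -> coprime n.+1 (f_ a n) ->
  eventually_identity a.
Proof.
move=> a_gt0 n_ge2 hE cn; exists n => m lt_nm.
have [y|y|fE _] := f_sweep (m := m - n) a_gt0 n_ge2 (ltn0Sn n) cn.
- by rewrite hE inE.
- by rewrite hE inE; lia.
have -> : m = (n + (m - n).-1).+1 by lia.
by rewrite fE; lia.
Qed.

(** * The least prime not dividing a number *)

Lemma coprime_addl m n : coprime (m + n) m = coprime n m.
Proof. by rewrite coprime_sym /coprime gcdnDl gcdnC. Qed.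

Lemma ex_gap e : exists d, (1 < d) && ((0 < e) ==> coprime d e).
Proof. by case: e => [|e]; [exists 2 | exists e.+2; rewrite coprimeSn]. Qed.

(** Described through coprimality, as the recursion uses it; [prime_gap] shows
that for positive [e] this is the least prime not dividing [e]. *)
Definition gap e := ex_minn (ex_gap e).

Lemma gap_gt1 e : 1 < gap e.
Proof. by rewrite /gap; case: ex_minnP => d /andP[]. Qed.

Lemma coprime_gap e : 0 < e -> coprime (gap e) e.
Proof. by move=> e0; rewrite /gap; case: ex_minnP => d /andP[_ /implyP->]. Qed.

Lemma gap_min e d : 1 < d -> coprime d e -> gap e <= d.
Proof.
by rewrite /gap => d1 cd; case: ex_minnP => m _; apply; rewrite d1 cd implybT.
Qed.

Lemma prime_gap e : 0 < e -> prime (gap e).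
Proof.
move=> e_gt0; have pr := pdiv_prime (gap_gt1 e).
have cp := coprime_dvdl (pdiv_dvd (gap e)) (coprime_gap e_gt0).
have le := gap_min (prime_gt1 pr) cp.
suff -> : gap e = pdiv (gap e) by [].
by apply/eqP; rewrite eqn_leq le pdiv_leq // ltnW // gap_gt1.
Qed.

Lemma dvdn_lt_gap e l : prime l -> l < gap e -> l %| e.
Proof.
move=> pr_l; apply: contraTT => lNe.
by rewrite -leqNgt gap_min ?prime_gt1 // prime_coprime.
Qed.

(** A common prime factor of [x] and [e + gap e] divides their difference, so
it is smaller than [gap e] and divides [e], hence also [gap e]. This is why
the numbers that a jump skips can be listed right after it. *)
Lemma coprime_jump e x : 0 < e -> e < x < e + gap e -> coprime x (e + gap e).
Proof.
move=> e_gt0 /andP[ex xr]; apply/negPn/negP => ncop.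
have g_gt1 : 1 < gcdn x (e + gap e).
  by move: ncop; rewrite /coprime; have : 0 < gcdn x (e + gap e);
     [rewrite gcdn_gt0; lia | lia].
set l := pdiv (gcdn x (e + gap e)).
have pr_l : prime l by exact: pdiv_prime.
have lx : l %| x := dvdn_trans (pdiv_dvd _) (dvdn_gcdl _ _).
have lr : l %| e + gap e := dvdn_trans (pdiv_dvd _) (dvdn_gcdr _ _).
have le : l %| e.
  apply: dvdn_lt_gap => //.
  apply: (@leq_ltn_trans (e + gap e - x)); last by lia.
  by apply: dvdn_leq; [lia | exact: dvdn_sub].
have lg : l %| gap e by rewrite -(dvdn_addr _ le).
have : l %| gcdn (gap e) e by rewrite dvdn_gcd lg.
by rewrite (eqP (coprime_gap e_gt0)) dvdn1 => /eqP l1; rewrite l1 in pr_l.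
Qed.

Lemma odd_gap e : 0 < e -> ~~ odd e -> odd (gap e).
Proof.
move=> e_gt0 ev; apply/negPn/negP => evg.
have := coprime_gap e_gt0; rewrite /coprime => /eqP g1.
have : 2 %| gcdn (gap e) e by rewrite dvdn_gcd !dvdn2 ev evg.
by rewrite g1.
Qed.

Lemma gap_ge3 e : 0 < e -> ~~ odd e -> 2 < gap e.
Proof. by move=> e0 ev; have := odd_gap e0 ev; have := gap_gt1 e; lia. Qed.

Lemma gap_eq3 e : 0 < e -> ~~ odd e -> (gap e == 3) = ~~ (3 %| e).
Proof.
move=> e0 ev; apply/eqP/idP => [g3|N3].
  by have := coprime_gap e0; rewrite g3 prime_coprime.
apply/eqP; rewrite eqn_leq gap_ge3 // andbT.
by apply: gap_min => //; rewrite prime_coprime.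
Qed.

(** * The pivots *)

Definition next e := e + (gap e).-1.
Definition pivot k := iter k next 2.

Lemma even_next e : 0 < e -> ~~ odd e -> ~~ odd (next e).
Proof. by move=> e0 ev; have := odd_gap e0 ev; rewrite /next; lia. Qed.

Lemma pivotS k : pivot k.+1 = pivot k + (gap (pivot k)).-1.
Proof. by []. Qed.

Lemma pivotP k : (1 < pivot k) && ~~ odd (pivot k).
Proof.
elim: k => [|k /andP[g1 ev]]; first by [].
by rewrite (even_next (ltnW g1) ev) andbT pivotS ltn_addr.
Qed.

Lemma pivot_ge2 k : 1 < pivot k. Proof. by case/andP: (pivotP k). Qed.
Lemma pivot_gt0 k : 0 < pivot k. Proof. exact/ltnW/pivot_ge2. Qed.
Lemma even_pivot k : ~~ odd (pivot k). Proof. by case/andP: (pivotP k). Qed.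

Lemma ltn_pivot : {mono pivot : j k / j < k}.
Proof.
apply: leqW_mono; apply: leq_mono.
apply: homo_ltn => [|k]; first exact: ltn_trans.
by rewrite pivotS; have := gap_gt1 (pivot k); lia.
Qed.

Lemma pivot_bracket m : 2 < m -> exists k, pivot k < m <= pivot k.+1.
Proof.
move=> m_gt2.
have ub k : pivot k < m -> k <= m.
  suff : k <= pivot k by lia.
  elim: k => // k IHk; have := ltn_pivot k k.+1; lia.
have [k km maxk] := ex_maxnP (ex_intro (fun k => pivot k < m) 0 m_gt2) ub.
exists k; rewrite km leqNgt; apply/negP => /maxk; lia.
Qed.

(** If [p] were jumped over from the pivot [e], then [p - e], lying strictly
between 1 and [gap e], would have a prime factor dividing [e], thus dividing
[p]; but it is smaller than [p]. *)
Lemma prime_pivot p : prime p -> 2 < p -> exists k, p = (pivot k).+1.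
Proof.
move=> pr_p p_gt2; have [k /andP[kp pk]] := pivot_bracket p_gt2.
have [Ep|np] := eqVneq p (pivot k).+1; first by exists k.
set e := pivot k in kp np; have j_gt1 : 1 < p - e by lia.
have e_gt0 : 0 < e := pivot_gt0 k.
have pr_l := pdiv_prime j_gt1; set l := pdiv _ in pr_l.
have l_j : l %| p - e := pdiv_dvd _.
have l_le : l <= p - e by apply: dvdn_leq; lia.
have le : l %| e.
  apply: dvdn_lt_gap => //.
  by move: pk; rewrite pivotS -/e; have := gap_gt1 e; lia.
have : l %| p by rewrite -(subnK (ltnW kp)) dvdn_add.
rewrite dvdn_prime2 // => /eqP; lia.
Qed.

Lemma pivot1 : pivot 1 = 4.
Proof. by have := gap_eq3 (e := 2) isT isT; rewrite pivotS => /eqP->. Qed.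

(** A gap 3 occurs when 3 does not divide the pivot, and sends 2 to 4 and 4 to
0. A larger gap is a prime other than 3 and starts from a multiple of 6, so
that the next pivot is not 2 modulo 3. *)
Lemma pivotS_mod6 k : (pivot k.+1 %% 6 == 0) || (pivot k.+1 %% 6 == 4).
Proof.
elim: k => [|k]; first by rewrite pivot1.
set e := pivot k.+1 => IHk.
have e0 : 0 < e by exact: pivot_gt0.
have ev : ~~ odd e by exact: even_pivot.
have og := odd_gap e0 ev; have pr := prime_gap e0; have g1 := gap_gt1 e.
rewrite pivotS -/e; case: (eqVneq (gap e) 3) => g3.
  have : ~~ (3 %| e) by rewrite -gap_eq3 // g3.
  by rewrite g3; lia.
have e3 : 3 %| e by move: g3; rewrite gap_eq3 // negbK.
have : ~~ (3 %| gap e) by rewrite dvdn_prime2 // eq_sym.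
lia.
Qed.

(** * Filling the intervals between pivots *)

(** This covers two regimes: [a <= e.+1], where the history is an initial
segment and [n = e.+1], and [e.+1 < a], where [a] is an isolated value used
ahead of time and [n = e.+2]. *)
Definition swept a n e :=
  f_ a n = e /\ history a n =i [pred y | (0 < y <= e.+1) || (y == a)].

Lemma swept_jump a n e : 0 < a -> 2 <= n -> 0 < e -> a <> e + gap e ->
  swept a n e -> f_ a n.+1 = e + gap e.
Proof.
move=> a0 n2 e0 aN [fE hE]; have g1 := gap_gt1 e.
apply: f_step; [by []|by []|lia| | |].
- by rewrite hE inE; lia.
- by rewrite fE coprime_addl coprime_gap.
move=> k /andP[k0 kr]; rewrite fE => ck; rewrite hE inE k0 /=.
case: leqP => //= ek; have ck' : coprime (k - e) e.
  by rewrite -(coprime_addl e) subnKC // ltnW // ltnW.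
have := @gap_min e (k - e); rewrite ck'; lia.
Qed.

Lemma swept_next a n e : 0 < a -> 2 <= n -> 0 < e -> ~~ odd e ->
  ~~ (e.+1 < a <= e + gap e) -> swept a n e ->
  (forall i, i.+2 < gap e -> f_ a (n + i).+2 = e.+2 + i) /\
  swept a (n + (gap e).-1) (next e).
Proof.
move=> a0 n2 e0 ev aN st; have g3 := gap_ge3 e0 ev.
have fS : f_ a n.+1 = e + gap e by apply: swept_jump => //; lia.
case: st => fE hE.
have hS y : (y \in history a n.+1) =
    [|| y == e + gap e, 0 < y <= e.+1 | y == a].
  by rewrite history_cons fS inE hE.
have [|||y|y|fi hi] := @f_sweep a n.+1 e.+2 (gap e - 2) a0.
- by lia.
- by [].
- by rewrite fS; apply: coprime_jump; lia.
- by rewrite hS; lia.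
- by rewrite hS; lia.
split=> [i i_lt|]; first by rewrite -addSn fi //; lia.
have En : n + (gap e).-1 = n.+1 + (gap e - 2) by lia.
rewrite /swept /next; split.
  have -> : n + (gap e).-1 = (n.+1 + (gap e - 3)).+1 by lia.
  by rewrite fi; lia.
by move=> y; rewrite En hi hS inE; lia.
Qed.

(** The situation reproduces itself for arbitrarily large [e], and each time
the place [e.+1] carries the value [e]. *)
Lemma swept_not_identity a e : 0 < a <= e.+1 -> 0 < e -> ~~ odd e ->
  swept a e.+1 e -> ~ eventually_identity a.
Proof.
move=> ale e0 ev st [m idm].
suff [e' [me' [fE _]]] : exists e', e + m <= e' /\ swept a e'.+1 e'.
  have := idm e'.+1; rewrite fE; lia.
elim: m {idm} e ale e0 ev st => [|m IHm] e ale e0 ev st.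
  by exists e; rewrite addn0.
have g1 := gap_gt1 e.
have [||||||_ st'] := @swept_next a e.+1 e; [lia|lia|by []|by []|lia|by []|].
have En : e.+1 + (gap e).-1 = (next e).+1 by rewrite /next; lia.
rewrite En in st'; have lt_e : e < next e by rewrite /next; lia.
have [||||e' [me' st_e']] := IHm (next e); [lia|lia|exact: even_next|by []|].
by exists e'; split=> //; lia.
Qed.

(** The passage over [a]: the only moment at which the sequence can become the
identity. *)
Lemma swept_cross a e : 0 < e -> ~~ odd e -> ~~ odd a -> e.+1 < a <= next e ->
  swept a e.+2 e ->
  eventually_identity a <-> a = next e /\ (gap e = 3 \/ ~~ (3 %| a.-1)).
Proof.
move=> e0 ev eva /andP[ea ar] st; have g3 := gap_ge3 e0 ev.
have a0 : 0 < a by lia.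
set r := e + gap e; have rE : r = (next e).+1 by rewrite /r /next; lia.
have fS : f_ a e.+3 = r by apply: swept_jump => //; lia.
case: st => _ hE.
have [] : f_ a a.+1 = (if a == e.+2 then r else a.-1) /\
          history a a.+1 =i [pred y | (0 < y <= a) || (y == r)].
  have hS y : (y \in history a e.+3) =
      [|| y == r, 0 < y <= e.+1 | y == a].
    by rewrite history_cons fS inE hE.
  have [|||y|y|fi hi] := @f_sweep a e.+3 e.+2 (a - e.+2) a0.
  - by [].
  - by [].
  - by rewrite fS; apply: coprime_jump; lia.
  - by rewrite hS; lia.
  - by rewrite hS; lia.
  have En : a.+1 = e.+3 + (a - e.+2) by lia.
  split=> [|y]; last by rewrite En hi hS inE; lia.
  case: eqP => [aE|aN]; first by rewrite -fS -aE.
  have -> : a.+1 = (e.+3 + (a - e.+3)).+1 by lia.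
  by rewrite fi; lia.
move=> vE hv.
case: (eqVneq a (next e)) => [aE|aN]; last first.
  (* The value before [a.+1] is either the jump itself or the odd [a.-1], and
     is coprime to [a.+1]: the filling goes on past [a] and ends at [next e],
     leaving an initial segment used. *)
  split=> [id_a|[]]; last by move/eqP: aN.
  exfalso; move: id_a.
  have [|||y|y|fi hi] := @f_sweep a a.+1 a.+1 (next e - a) a0.
  - by lia.
  - by [].
  - rewrite vE; case: eqP => _; first by apply: coprime_jump; lia.
    have -> : a.+1 = a.-1 + 2 by lia.
    by rewrite coprime_addl coprime2n; lia.
  - by rewrite hv inE; lia.
  - by rewrite hv inE; lia.
  apply: (@swept_not_identity a (next e)); [lia|lia|exact: even_next|].
  have En : (next e).+1 = a.+1 + (next e - a) by lia.
  split=> [|y]; last by rewrite En hi hv !inE; lia.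
  have -> : (next e).+1 = (a.+1 + (next e - a.+1)).+1 by lia.
  by rewrite fi; lia.
have ha : history a a.+1 =i [pred y | 0 < y <= a.+1].
  by move=> y; rewrite hv !inE; lia.
have cop3 : coprime a.+2 a.-1 = ~~ (3 %| a.-1).
  have -> : a.+2 = a.-1 + 3 by lia.
  by rewrite coprime_addl prime_coprime.
have [a2|aN2] := eqVneq a e.+2.
  have g_eq3 : gap e = 3 by move: aE; rewrite /next; lia.
  split=> [_|_]; first by split; [|left].
  apply: (identity_from a0 (n := a.+1)) => //.
  by rewrite vE a2 eqxx rE -aE a2 coprimeSn.
have g_neq3 : gap e <> 3 by move: aE; rewrite /next; lia.
have fa : f_ a a.+1 = a.-1 by rewrite vE (negbTE aN2).
split=> [id_a|[_ [//|a3]]]; last first.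
  by apply: (identity_from a0 (n := a.+1)) => //; rewrite fa cop3.
(* Since 3 divides [a.-1] and [a.+2], the next values are [a.+3], then [a.+2],
   which is the recurring situation with last value [a.+2]. *)
split=> //; right; apply/negP => a3; move: id_a.
have f2 : f_ a a.+2 = a.+3.
  apply: f_step; [by []|by []|by []| | |].
  - by rewrite ha inE; lia.
  - rewrite fa; have -> : a.+3 = a.-1 + 2 ^ 2 by lia.
    by rewrite coprime_addl coprimeXl // coprime2n; lia.
  - move=> k k_lt; rewrite fa ha inE.
    by case: (eqVneq k a.+2) => [->|]; [rewrite cop3 a3 | lia].
have h2 y : (y \in history a a.+2) = (y == a.+3) || (0 < y <= a.+1).
  by rewrite history_cons inE f2 ha.
have f3 : f_ a a.+3 = a.+2.
  apply: f_step; [by []|by []|by []| | |].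
  - by rewrite h2; lia.
  - by rewrite f2 coprimenS.
  - by move=> k k_lt _; rewrite h2; lia.
apply: (@swept_not_identity a a.+2); [lia|by []|by rewrite /= negbK|].
by split=> [//|y]; rewrite history_cons !inE f3 h2; lia.
Qed.

(** * The beginning of the sequence *)

Lemma swept_odd a : odd a -> 2 < a -> swept a a a.-1.
Proof.
move=> od a_gt2; have a0 : 0 < a by lia.
have h2 y : (y \in history a 2) = (y == a) || (y == 1) by rewrite !inE.
have [|||y|y|fi hi] := @f_sweep a 2 2 (a - 2) a0.
- by [].
- by [].
- by rewrite coprime2n.
- by rewrite h2; lia.
- by rewrite h2; lia.
have En : 2 + (a - 2) = a by lia.
split=> [|y]; last by have := hi y; rewrite En h2 inE => ->; lia.
have := fi (a - 3); have -> : (2 + (a - 3)).+1 = a by lia.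
by move=> ->; lia.
Qed.

Lemma odd_not_identity a : odd a -> ~ eventually_identity a.
Proof.
move=> od; have [a2|] := ltnP 2 a.
  apply: (@swept_not_identity a a.-1); [lia|lia|lia|].
  by rewrite prednK; [exact: swept_odd | lia].
move=> a2; have {a2 od}-> : a = 1 by lia.
case=> m idm; have [|||y|y|fi _] := @f_sweep 1 2 2 m.+1 isT.
- by [].
- by [].
- by [].
- by rewrite !inE; lia.
- by rewrite !inE; lia.
by have := idm (2 + m).+1; rewrite fi //; lia.
Qed.

Lemma gap_lt a : 2 < a -> gap a < a.
Proof.
move=> a2; have : gap a <= a.-1; last by lia.
by apply: gap_min; [lia | rewrite coprimePn; lia].
Qed.

(** After [1] and [a] comes [gap a], a prime [p], which lets 2, ..., [p - 1]
follow; and [p - 1] is a pivot. *)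
Lemma swept_start a : 2 < a -> ~~ odd a -> swept a (gap a).+1 (gap a).-1.
Proof.
move=> a2 ev; have a0 : 0 < a by lia.
have g3 := gap_ge3 a0 ev; have ga := gap_lt a2.
have h2 y : (y \in history a 2) = (y == a) || (y == 1) by rewrite !inE.
have f3 : f_ a 3 = gap a.
  apply: f_step; [by []|by []|lia| | |].
  - by rewrite h2; lia.
  - exact: coprime_gap.
  - by move=> k k_lt ck; rewrite h2; have := @gap_min a k; rewrite ck; lia.
have h3 y : (y \in history a 3) = [|| y == gap a, y == a | y == 1].
  by rewrite history_cons inE f3 h2.
have [|||y|y|fi hi] := @f_sweep a 3 2 (gap a - 2) a0.
- by [].
- by [].
- by rewrite f3 coprime2n odd_gap.
- by rewrite h3; lia.
- by rewrite h3; lia.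
have En : (gap a).+1 = 3 + (gap a - 2) by lia.
split=> [|y]; last by rewrite En hi h3 inE; lia.
have -> : (gap a).+1 = (3 + (gap a - 3)).+1 by lia.
by rewrite fi; lia.
Qed.

Lemma swept_pivot a j k : ~~ odd a -> j <= k -> (pivot k).+1 < a ->
  swept a (pivot j).+2 (pivot j) -> swept a (pivot k).+2 (pivot k).
Proof.
move=> ev; elim: k => [|k IHk].
  by rewrite leqn0 => /eqP->.
rewrite leq_eqVlt => /predU1P[-> //|jk] ka st.
have e0 := pivot_gt0 k; have ek := even_pivot k.
have g1 := gap_gt1 (pivot k); have kE := pivotS k.
have st_k := IHk jk ltac:(lia) st.
have [||||||_] := @swept_next a (pivot k).+2 (pivot k);
  [lia|by []|by []|by []|lia|by []|].
by have -> : (pivot k).+2 + (gap (pivot k)).-1 = (pivot k.+1).+2 by lia.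
Qed.

(** The sequence follows the pivots until the pair that brackets [a]; the
criterion of [swept_cross] then applies. *)
Lemma even_identity a : 2 < a -> ~~ odd a ->
  eventually_identity a <->
  exists k, a = pivot k.+1 /\ (gap (pivot k) = 3 \/ ~~ (3 %| a.-1)).
Proof.
move=> a2 ev; have a0 : 0 < a by lia.
have [j jE] := prime_pivot (prime_gap a0) (gap_ge3 a0 ev).
have [k /andP[ka ak]] := pivot_bracket a2.
have ek := even_pivot k.
have jk : j <= k.
  by rewrite -ltnS -ltn_pivot; apply: leq_trans ak; have := gap_lt a2; lia.
have st : swept a (pivot k).+2 (pivot k).
  apply: (swept_pivot ev jk); first by lia.
  by have := swept_start a2 ev; rewrite jE.
have ka' : (pivot k).+1 < a <= next (pivot k).
  by rewrite -/(pivot k.+1) ak andbT; lia.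
rewrite (swept_cross (pivot_gt0 k) ek ev ka' st); split=> [|[i [aE aP]]].
  by exists k.
suff ik : i = k by rewrite -ik.
have : k < i.+1 by rewrite -ltn_pivot -aE.
have : ~~ (k.+1 < i.+1) by rewrite -ltn_pivot -aE -leqNgt.
by lia.
Qed.

(** * Records of [f_ 3] and the classification *)

Lemma swept3 k : swept 3 (pivot k).+1 (pivot k).
Proof.
elim: k => [|k IHk]; first exact: (@swept_odd 3).
have e2 := pivot_ge2 k; have g1 := gap_gt1 (pivot k); have kE := pivotS k.
have [||||||_] := @swept_next 3 (pivot k).+1 (pivot k);
  [by []|lia|lia|exact: even_pivot|lia|exact: IHk|].
by have -> : (pivot k).+1 + (gap (pivot k)).-1 = (pivot k.+1).+1 by lia.
Qed.

(** Only the jump from a pivot increases the value by more than one; inside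
the interval that follows, the values go down once and then up by ones. *)
Lemma records3 r : records 3 r <-> exists k, r = (pivot k.+1).+1.
Proof.
have block k : f_ 3 (pivot k).+2 = (pivot k.+1).+1 /\
  forall t, (pivot k).+2 < t <= (pivot k.+1).+1 -> f_ 3 t = t.-1.
  have e2 := pivot_ge2 k; have kE := pivotS k.
  have g3 := gap_ge3 (pivot_gt0 k) (even_pivot k).
  have [||||||fi _] := @swept_next 3 (pivot k).+1 (pivot k);
    [by []|lia|lia|exact: even_pivot|lia|exact: swept3|].
  split=> [|t t_in].
    by rewrite (@swept_jump 3 (pivot k).+1 (pivot k));
      [lia|by []|lia|lia|lia|exact: swept3].
  have -> : t = ((pivot k).+1 + (t - (pivot k).+3)).+2 by lia.
  by rewrite fi; lia.
split=> [[t [tp ->]]|[k ->]]; last first.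
  exists (pivot k).+2; have [fE _] := block k; split=> //; left.
  have e2 := pivot_ge2 k; have kE := pivotS k.
  have g3 := gap_ge3 (pivot_gt0 k) (even_pivot k).
  by rewrite fE [_.+2.-1]/= (proj1 (swept3 k)); lia.
case: tp => [[t3 jump]|[-> []]]; last first.
  have -> : f_ 3 3 = 2 by exact: (proj1 (swept3 0)).
  by split=> [|m []]; [split | lia].
have [|k k_t] := @pivot_bracket t.-1; first by lia.
have [fE ft] := block k; exists k.
have [tE|tN] := eqVneq t (pivot k).+2; first by rewrite tE.
exfalso; move: jump; rewrite (ft t); last by lia.
have [tE|tN'] := eqVneq t.-1 (pivot k).+2; first by rewrite tE fE; lia.
by rewrite (ft t.-1); lia.
Qed.

Lemma identity_starts a : 0 < a -> eventually_identity a <->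
  a = 2 \/ a = 4 \/ (a = 0 %[mod 6] /\ exists k, a = pivot k.+1).
Proof.
move=> a0; have [od|ev] := boolP (odd a).
  by split=> [/(odd_not_identity od)//|[|[|[a6 _]]]]; lia.
have [a2|] := ltnP 2 a; last first.
  move=> a2; have -> : a = 2 by lia.
  split=> _; first by left.
  by apply: (@identity_from 2 2) => // y; rewrite !inE; lia.
rewrite even_identity //; split=> [[k [aE aP]]|[|[]]]; first last.
- by case=> a6 [k aE]; exists k; split=> //; right; lia.
- move=> a4; exists 0; rewrite pivot1; split=> //; left.
  by have := pivotS 0; rewrite pivot1 (_ : pivot 0 = 2) //; lia.
- by move=> aE; exfalso; lia.
right; case: k aE aP => [|k] aE aP; first by rewrite aE pivot1; left.
right; split; last by exists k.+1.
have := pivotS_mod6 k; have := pivotS_mod6 k.+1; rewrite -aE.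
case: aP => [g3|]; last by lia.
by move: aE; rewrite pivotS g3; lia.
Qed.

Theorem theorem2p6 :
  (eventually_identity_starts =
   [set 2; 4]%N `|`
   [set a : nat | [/\ (0 < a)%N, a = 0 %[mod 6] &
      exists r : nat, records 3 r /\ (`|r%:Z - a%:Z| <= 1)%R]])%classic.
Proof.
rewrite eqEsubset; split=> a /=.
  case=> a0 /(identity_starts a0)[|[]]; [by left; left|by left; right|].
  case=> a6 [k aE]; right; split=> //; exists a.+1.
  by split; [apply/records3; exists k; rewrite aE | lia].
case=> [[->|->]|[a0 a6 [r [/records3[k rE] ra]]]]; split=> //.
- by apply/identity_starts => //; left.
- by apply/identity_starts => //; right; left.
apply/identity_starts => //; right; right; split=> //.
have ek := even_pivot k.+1; have := pivotS_mod6 k.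
(* [a] is the pivot below the record, or exceeds it by 2; in that case the
   pivot is 4 modulo 6, and [a] is the pivot after it. *)
have [aE _|aN k6] := eqVneq a (pivot k.+1); first by exists k.
exists k.+1; have : gap (pivot k.+1) == 3.
  by rewrite gap_eq3 ?pivot_gt0 //; lia.
by rewrite (pivotS k.+1) => /eqP->; lia.
Qed.
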